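(* Let $N\ge 1$ be an integer, $0<p<1$, and let the offspring distribution of a Bienaymé–Galton–Watson process be geometric, $p_k=(1-p)p^k$ for $k\ge 0$, with mean $m=p/(1-p)$. Let $V_N$ be the number of disjoint complete infinite $N$-ary subtrees rooted at the ancestor of the family tree. Then $V_N$ is geometric as well: $$P(V_N=j)=(1-\tau_N)\tau_N^{\,j}\quad (j\ge 0),\qquad E V_N=\tau_N(1-\tau_N)^{-1},$$ where $\tau_N$ is the largest solution $\tau$ in $[0,1]$ of $$\left(\tau+\frac1m\right)^N=\tau^{N-1}$$ (with $\tau_N=0$ if this equation has no solution in $[0,1]$).
   Context: The process starts with one ancestor (the root); each individual independently has $k$ children with probability $p_k$. The family tree has the individuals as nodes and the parent–child relations as arcs. A complete infinite $N$-ary tree is a rooted tree in which every node has exactly $N$ children. Subtrees considered are those rooted at the ancestor; two such subtrees are disjoint if they have no common node other than the root. $V_N$ is the (maximal) number of pairwise disjoint complete infinite $N$-ary subtrees of the family tree rooted at the ancestor. Convention: $0^0=1$. *)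

(* Defs.v *)
From mathcomp Require Import all_boot all_order all_algebra.
From mathcomp Require Import all_classical all_reals all_analysis.

Set Implicit Arguments.
Unset Strict Implicit.
Unset Printing Implicit Defensive.

Import Order.TTheory GRing.Theory Num.Theory.
Import numFieldNormedType.Exports.

Local Open Scope classical_set_scope.
Local Open Scope ring_scope.

Definition mutually_independent (d : measure_display) (T : measurableType d)
    (R : realType) (P : probability T R) (I : choiceType) (d' : measure_display)
    (T' : measurableType d') (X : I -> {RV P >-> T'}) : Prop :=
  forall (s : seq I) (B : I -> set T'),
    uniq s -> (forall i, measurable (B i)) ->
    P (\bigcap_(i in [set` s]) (X i @^-1` B i)) =
    (\prod_(i <- s) P (X i @^-1` B i))%E.

Arguments mutually_independent {d T R} P {I d' T'} X.

(* Ulam-Harris labelling: a potential individual is a word over nat, the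
   ancestor is [::], and the i-th child of u (i = 0, 1, ...) is rcons u i.
   With offspring numbers x, the individual u is born iff each of its
   ancestors v has enough children for the next letter of u to be used. *)
Definition family_tree (x : seq nat -> nat) : set (seq nat) :=
  [set u | forall (v : seq nat) (i : nat), prefix (rcons v i) u -> (i < x v)%N].

(* Node sets of the complete infinite N-ary subtrees of A rooted at [::];
   closure under parents makes such a node set connected to the root. *)
Definition complete_nary_subtree (N : nat) (A S : set (seq nat)) : Prop :=
  [/\ S `<=` A,
      S [::],
      forall u i, S (rcons u i) -> S u &
      forall u, S u -> ([set i | S (rcons u i)] #= `I_N)%card].

Definition disjoint_nary_subtrees (N : nat) (A : set (seq nat)) (k : nat)
    (S : 'I_k -> set (seq nat)) : Prop :=
  (forall i, complete_nary_subtree N A (S i)) /\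
  (forall i j, i != j -> S i `&` S j = [set [::]]).

(* The supremum is taken in \bar R so that no finiteness is presupposed. *)
Definition num_disjoint_nary_subtrees (R : realType) (N : nat)
    (A : set (seq nat)) : \bar R :=
  ereal_sup [set (k%:R)%:E | k in
    [set k : nat | exists S : 'I_k -> set (seq nat),
       disjoint_nary_subtrees N A S]].

Definition tau_solutions (R : realType) (N : nat) (m : R) : set R :=
  [set t | 0 <= t <= 1 /\ (t + 1 / m) ^+ N = t ^+ N.-1].

Definition is_tau (R : realType) (N : nat) (m t : R) : Prop :=
  (tau_solutions N m t /\ ubound (tau_solutions N m) t) \/
  (tau_solutions N m = set0 /\ t = 0).

(* Main.v *)
(* Call a node N-ary if it is the root of a complete infinite N-ary subtree.  As
   offspring numbers are finite, a compactness argument shows that a node is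
   N-ary iff at least N of its children are; moreover V_N is the integer part of
   Z / N, where Z counts the N-ary children of the ancestor.  The children are
   N-ary independently with probability t, and a geometric number of independent
   marks of probability t is again geometric, here of ratio
   r = p t / (1 - p + p t) = m t / (1 + m t).  Hence P(V_N >= j) = r ^ (N j),
   and t = P(V_N >= 1) = r ^ N.  Finally t is the limit of the iterates at 1 of
   the increasing map s |-> (m s / (1 + m s)) ^ N, hence its largest fixed point
   in [0, 1]; for s > 0 the fixed point equation is the one defining tau_N. *)

Require Import Defs.
From mathcomp Require Import all_boot all_order all_algebra.
From mathcomp Require Import finmap.
From mathcomp Require Import all_classical all_reals all_analysis.
From mathcomp Require Import measurable_realfun.
From mathcomp Require Import ring lra.

Import Order.TTheory GRing.Theory Num.Theory.
Import numFieldNormedType.Exports.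

Local Open Scope classical_set_scope.
Local Open Scope ring_scope.

Set Implicit Arguments.
Unset Strict Implicit.
Unset Printing Implicit Defensive.

(** * N-ary nodes: finite-depth approximations and compactness *)

Lemma card_eq_II_seqP (T : choiceType) (A : set T) (n : nat) :
  (A #= `I_n)%card <-> exists s : seq T, [/\ uniq s, size s = n & A = [set` s]].
Proof.
split=> [An|[s [us <- ->]]].
  have [X AX] : exists X : {fset T}, A = [set` X].
    by apply/finite_fsetP/finite_setP; exists n.
  exists X; split; [exact: fset_uniq| |exact: AX].
  by apply/card_eq_fsetP; rewrite -AX.
have -> : [set` s] = [set` [fset x in s]%fset].
  by apply/seteqP; split=> x /=; rewrite inE.
by apply/card_eq_fsetP; rewrite card_fseq undup_id.
Qed.

(** An ordered list without repetition, so that blocks of [N] children can be cut out of it; [G]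
    stands for the finite-depth or the limiting notion of N-ary node. *)
Definition marked_children (G : pred (seq nat)) (k : nat) (u : seq nat) :
    seq nat :=
  [seq i <- iota 0 k | G (rcons u i)].

Lemma mem_marked_children (G : pred (seq nat)) (k : nat) (u : seq nat)
    (i : nat) :
  (i \in marked_children G k u) = (i < k)%N && G (rcons u i).
Proof. by rewrite mem_filter mem_iota add0n leq0n andbC. Qed.

Lemma marked_children_uniq (G : pred (seq nat)) (k : nat) (u : seq nat) :
  uniq (marked_children G k u).
Proof. exact/filter_uniq/iota_uniq. Qed.

Lemma size_marked_childrenS (G : pred (seq nat)) (k : nat) (u : seq nat) :
  size (marked_children G k.+1 u) =
  (size (marked_children G k u) + G (rcons u k))%N.
Proof.
by rewrite /marked_children !size_filter -addn1 iotaD count_cat/= addn0.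
Qed.

Lemma sub_size_marked_children (G H : pred (seq nat)) (k : nat) (u : seq nat) :
  (forall i, (i < k)%N -> G (rcons u i) -> H (rcons u i)) ->
  (size (marked_children G k u) <= size (marked_children H k u))%N.
Proof.
move=> GH; apply: uniq_leq_size; first exact: marked_children_uniq.
by move=> i; rewrite !mem_marked_children => /andP[ik Gi]; rewrite ik GH.
Qed.

(** Being N-ary down to depth [n]. Whether [u] itself is born is not asked, so only the offspring
    numbers at [u] and below matter. *)
Fixpoint nary_upto (x : seq nat -> nat) (N n : nat) (u : seq nat) : bool :=
  if n is n'.+1 then
    (N <= size (marked_children (nary_upto x N n') (x u) u))%N
  else true.

Lemma nary_uptoS (x : seq nat -> nat) (N n : nat) (u : seq nat) :
  nary_upto x N n.+1 u -> nary_upto x N n u.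
Proof.
elim: n u => // n IH u /= /leq_trans; apply.
by apply: sub_size_marked_children => i _; exact: IH.
Qed.

Lemma nary_upto_leq (x : seq nat -> nat) (N m n : nat) (u : seq nat) :
  (m <= n)%N -> nary_upto x N n u -> nary_upto x N m u.
Proof.
elim: n => [|n IH]; first by rewrite leqn0 => /eqP ->.
by rewrite leq_eqVlt => /predU1P[->//|mn] /nary_uptoS; exact: IH.
Qed.

(** Stated as a countable intersection, which makes measurability easy; actual infinite subtrees are
    recovered through [nary_rootE]. *)
Definition nary_root (x : seq nat -> nat) (N : nat) (u : seq nat) : bool :=
  `[< forall n, nary_upto x N n u >].

(* Compactness: each of the finitely many children of [u] that is not an N-ary
   root already fails at some finite depth; take the largest of these depths. *)
Lemma nary_upto_stable (x : seq nat -> nat) (N k : nat) (u : seq nat) :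
  exists n, forall i, (i < k)%N ->
    nary_upto x N n (rcons u i) -> nary_root x N (rcons u i).
Proof.
elim: k => [|k [n IH]]; first by exists 0%N.
have [/asboolP kroot|/asboolPn/existsNP[m km]] :=
  boolP (nary_root x N (rcons u k)).
  exists n => i; rewrite ltnS leq_eqVlt => /predU1P[-> _|]; last exact: IH.
  exact/asboolP.
exists (maxn m n) => i; rewrite ltnS leq_eqVlt => /predU1P[->|ik].
  by move=> /(nary_upto_leq (leq_maxl m n))/km.
by move=> /(nary_upto_leq (leq_maxr m n)); exact: IH.
Qed.

Lemma nary_rootE (x : seq nat -> nat) (N : nat) (u : seq nat) :
  nary_root x N u =
  (N <= size (marked_children (nary_root x N) (x u) u))%N.
Proof.
apply/idP/idP => [/asboolP uroot|le_N].
  (* With [n] the stabilising depth, the children counted at depth [n.+1] of [u] are already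
     N-ary. *)
  have [n stable] := nary_upto_stable x N (x u) u.
  by apply: leq_trans (uroot n.+1) _; exact: sub_size_marked_children.
apply/asboolP => -[//|n]; apply: leq_trans le_N _.
by apply: sub_size_marked_children => i _ /asboolP.
Qed.

(** * Disjoint subtrees counted by the N-ary children of the ancestor *)

(** Induction on the depth for all nodes of [S] together: the [N] children of [u] inside [S] are
    N-ary to the previous depth. *)
Lemma complete_nary_subtree_root (x : seq nat -> nat) (N : nat)
    (S : set (seq nat)) :
  complete_nary_subtree N (family_tree x) S -> forall u, S u -> nary_root x N u.
Proof.
move=> [SA _ _ Scard] u Su; apply/asboolP => n.
elim: n u Su => // n IH u Su.
have /card_eq_II_seqP[s [us szs sE]] := Scard u Su.
rewrite /= -[leqLHS]szs; apply: uniq_leq_size us _ => i si.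
have Sui : S (rcons u i) by rewrite -[S _]/([set j | S (rcons u j)] i) sE.
rewrite mem_marked_children IH// andbT.
by apply: (SA _ Sui); exact: prefix_refl.
Qed.

(** Disjoint subtrees share no child of the ancestor, so their [k] lists of [N] children concatenate
    to a repetition-free list of marked children. *)
Lemma leq_marked_children_disjoint_subtrees (x : seq nat -> nat) (N k : nat)
    (S : 'I_k -> set (seq nat)) :
  disjoint_nary_subtrees N (family_tree x) S ->
  (N * k <= size (marked_children (nary_root x N) (x [::]) [::]))%N.
Proof.
move=> [Ssub Sdisj].
have /choice[s sP] : forall i, exists s : seq nat,
    [/\ uniq s, size s = N & [set j | S i [:: j]] = [set` s]].
  move=> i; apply/card_eq_II_seqP.
  by have [_ Si0 _ /(_ [::] Si0)] := Ssub i.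
have sE i j : S i [:: j] = (j \in s i).
  by have [_ _ /seteqP[sS Ss]] := sP i; apply/propext; split=> [/sS|/Ss].
pose t := [seq j | i <- enum 'I_k, j <- s i].
have -> : (N * k)%N = size t.
  rewrite size_allpairs_dep sumnE big_map big_enum/=.
  under eq_bigr do rewrite (let: And3 _ szs _ := sP _ in szs).
  by rewrite sum_nat_const card_ord mulnC.
apply: uniq_leq_size => [|j /allpairsPdep[i [l [_ li ->]]]]; last first.
  have Sil : S i [:: l] by rewrite sE.
  have [SA _ _ _] := Ssub i.
  rewrite mem_marked_children (complete_nary_subtree_root (Ssub i))// andbT.
  by apply: (SA _ Sil); exact: prefix_refl.
apply: allpairs_uniq_dep => [|i _|]; first exact: enum_uniq.
  by have [] := sP i.
move=> _ _ /allpairsPdep[i [a [_ ai ->]]] /allpairsPdep[j [b [_ bj ->]]] /= ab.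
rewrite -ab in bj *; have [->//|ij] := eqVneq i j.
have /seteqP[/(_ [:: a]) + _] := Sdisj i j ij.
by rewrite /= !sE => /(_ (conj ai bj)).
Qed.

(* The [i]-th subtree uses the [i]-th block of [N] marked children of the
   ancestor and, at every other node, the first [N] marked children. *)
Definition chosen_children (x : seq nat -> nat) (N i : nat) (u : seq nat) :
    seq nat :=
  take N (drop (N * (u == [::]) * i)
    (marked_children (nary_root x N) (x u) u)).

Definition chosen_subtree (x : seq nat -> nat) (N i : nat) : set (seq nat) :=
  [set u | forall v a, prefix (rcons v a) u -> a \in chosen_children x N i v].

Lemma chosen_children_marked (x : seq nat -> nat) (N i a : nat)
    (u : seq nat) :
  a \in chosen_children x N i u -> (a < x u)%N && nary_root x N (rcons u a).
Proof. by move=> /mem_take/mem_drop; rewrite mem_marked_children. Qed.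

Lemma chosen_subtree_nil (x : seq nat -> nat) (N i : nat) :
  chosen_subtree x N i [::].
Proof. by move=> [|b v] a. Qed.

Lemma prefix_rconsr (T : eqType) (v u : seq T) (a : T) :
  prefix v (rcons u a) = prefix v u || (v == rcons u a).
Proof.
apply/idP/orP => [/prefixP[s]|[|/eqP ->]]; last exact: prefix_refl.
  case/lastP: s => [|s b]; first by rewrite cats0 => ->; right.
  by rewrite -rcons_cat => /rcons_inj[-> _]; left; exact: prefix_prefix.
by rewrite -cats1; exact: prefix_catl.
Qed.

Lemma chosen_subtree_rcons (x : seq nat -> nat) (N i a : nat) (u : seq nat) :
  chosen_subtree x N i (rcons u a) <->
  chosen_subtree x N i u /\ a \in chosen_children x N i u.
Proof.
split=> [Sua|[Su ua] v b].
  split=> [v b vu|]; last by apply: Sua; exact: prefix_refl.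
  by apply: Sua; rewrite prefix_rconsr vu.
rewrite prefix_rconsr => /orP[/Su//|/eqP/rcons_inj[-> ->]//].
Qed.

Lemma chosen_subtree_complete (x : seq nat -> nat) (N k i : nat) :
  (N * k <= size (marked_children (nary_root x N) (x [::]) [::]))%N ->
  (i < k)%N ->
  complete_nary_subtree N (family_tree x) (chosen_subtree x N i).
Proof.
move=> le_Nk lt_ik; split.
- by move=> u Su v a /Su/chosen_children_marked/andP[].
- exact: chosen_subtree_nil.
- by move=> u a /chosen_subtree_rcons[].
move=> u Su; apply/card_eq_II_seqP; exists (chosen_children x N i u); split.
- exact/take_uniq/drop_uniq/marked_children_uniq.
- rewrite /chosen_children size_take_min size_drop; apply/minn_idPl.
  (* At the ancestor at least [N * k - N * i >= N] entries remain after the drop; elsewhere the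
     offset is zero and the node, being marked, has [N] marked children. *)
  case/lastP: u Su => [_|u a /chosen_subtree_rcons[_ /chosen_children_marked]].
    rewrite eqxx muln1; apply: leq_trans (leq_sub2r (N * i) le_Nk).
    by rewrite -mulnBr leq_pmulr// subn_gt0.
  case/andP=> _; rewrite nary_rootE => le_N.
  by rewrite -size_eq0 size_rcons/= muln0 mul0n subn0.
apply/seteqP; split=> a /=; first by case/chosen_subtree_rcons.
by move=> ua; exact/chosen_subtree_rcons.
Qed.

(** A common node other than the root would start with a label lying in both blocks [i] and [j],
    which occupy different positions of a repetition-free list. *)
Lemma chosen_subtrees_disjoint (x : seq nat -> nat) (N i j : nat) :
  (i < j)%N ->
  chosen_subtree x N i `&` chosen_subtree x N j = [set [::]].
Proof.
move=> ij; apply/seteqP; split=> [[//|a u] [Si Sj]|_ ->]; last first.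
  by split; exact: chosen_subtree_nil.
have au : prefix (rcons [::] a) (a :: u) by rewrite /= eqxx prefix0s.
have := Sj [::] a au; have := Si [::] a au.
rewrite /chosen_children eqxx muln1.
set L := marked_children _ _ _ => ai /mem_take aj.
have : uniq (take (N * j) L ++ drop (N * j) L).
  by rewrite cat_take_drop; exact: marked_children_uniq.
rewrite cat_uniq => /and3P[_ /hasPn/(_ a aj)/negP + _]; case.
have : a \in drop (N * i) (take (N * j) L).
  have -> : (N * j = N * (j - i) + N * i)%N by rewrite -mulnDr subnK// ltnW.
  rewrite -take_drop.
  have -> : (N * (j - i) = N + N * (j - i).-1)%N.
    by rewrite -mulnS prednK// subn_gt0.
  by rewrite takeD mem_cat ai.
exact: mem_drop.
Qed.

Lemma disjoint_subtreesP (x : seq nat -> nat) (N k : nat) :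
  (exists S : 'I_k -> set (seq nat),
    disjoint_nary_subtrees N (family_tree x) S) <->
  (N * k <= size (marked_children (nary_root x N) (x [::]) [::]))%N.
Proof.
split=> [[S]|le_Nk]; first exact: leq_marked_children_disjoint_subtrees.
exists (fun i => chosen_subtree x N i); split=> [i|i j].
  exact: chosen_subtree_complete le_Nk (ltn_ord i).
rewrite -val_eqE/= neq_ltn => /orP[|ji]; first exact: chosen_subtrees_disjoint.
by rewrite setIC; exact: chosen_subtrees_disjoint.
Qed.

(** The admissible [k] are those with [N * k] at most the number of marked children; the integer
    quotient is the largest, so the supremum is attained. *)
Lemma num_disjoint_nary_subtreesE (R : realType) (x : seq nat -> nat)
    (N : nat) :
  (1 <= N)%N ->
  num_disjoint_nary_subtrees R N (family_tree x) =
  ((size (marked_children (nary_root x N) (x [::]) [::]) %/ N)%:R)%:E.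
Proof.
move=> N1; apply/eqP; rewrite eq_le; apply/andP; split.
  apply: ge_ereal_sup => _ [k /= /disjoint_subtreesP le_Nk <-].
  by rewrite lee_fin ler_nat leq_divRL// mulnC.
apply: ereal_sup_ubound; eexists; last by [].
by apply/disjoint_subtreesP; rewrite mulnC leq_divM.
Qed.

(** * Independence of sigma-algebras generated by disjoint families of variables *)

Lemma g_sigma_algebra_measurable (d : measure_display) (T : measurableType d)
    (G : set (set T)) :
  G `<=` measurable -> <<s G >> `<=` measurable.
Proof. by apply: smallest_sub; exact: sigma_algebra_measurable. Qed.

(** Dynkin's argument: the events independent of [B] form a lambda-system containing the pi-system
    [G]. *)
Lemma g_sigma_algebra_independent (d : measure_display) (T : measurableType d)
    (R : realType) (P : probability T R) (G : set (set T)) (B : set T) :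
  G `<=` measurable -> setI_closed G -> measurable B ->
  (forall A, G A -> P (A `&` B) = (P A * P B)%E) ->
  forall A, <<s G >> A -> P (A `&` B) = (P A * P B)%E.
Proof.
move=> Gm GI mB PG.
suff : <<s G >> `<=` [set A | measurable A /\ P (A `&` B) = (P A * P B)%E].
  by move=> sub A /sub[].
apply: lambda_system_subset => //; last first.
  by move=> A GA; split; [exact: Gm|exact: PG].
apply/dynkin_lambda_system; split => /=.
- by split; [exact: measurableT|rewrite setTI probability_setT mul1e].
- move=> A [mA PA]; split; first exact: measurableC.
  have -> : P (~` A `&` B) = (P B - P (A `&` B))%E.
    rewrite setIC -setDE measureD 1?setIC//.
    by rewrite (le_lt_trans (probability_le1 _ _)) ?ltry.
  rewrite PA probability_setC//.
  rewrite -(fineK (fin_num_measure P A mA)) -(fineK (fin_num_measure P B mB)).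
  by rewrite -[1%E]/(1%:E) -EFinM -!EFinB -EFinM mulrBl mul1r.
- move=> F tF /all_and2[mF PF]; split; first exact: bigcup_measurable.
  rewrite setI_bigcupl !measure_bigcup//.
  + rewrite muleC -(fineK (fin_num_measure P B mB)) -nneseriesZl//.
    apply: eq_eseriesr => k _; apply: etrans (PF k) _.
    by rewrite muleC fineK// fin_num_measure.
  + by move=> i _; exact: measurableI.
  + by apply: trivIset_setIr.
Qed.

Definition cylinders (d : measure_display) (T : measurableType d)
    (R : realType) (P : probability T R) (I : choiceType)
    (d' : measure_display) (T' : measurableType d')
    (X : I -> {RV P >-> T'}) (J : set I) : set (set T) :=
  [set A | exists (s : seq I) (B : I -> set T'),
    [/\ [set` s] `<=` J, forall i, measurable (B i) &
        A = \bigcap_(i in [set` s]) X i @^-1` B i]].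

Definition sigma_of (d : measure_display) (T : measurableType d)
    (R : realType) (P : probability T R) (I : choiceType)
    (d' : measure_display) (T' : measurableType d')
    (X : I -> {RV P >-> T'}) (J : set I) : set (set T) :=
  <<s cylinders X J >>.

Lemma cylinders_measurable (d : measure_display) (T : measurableType d)
    (R : realType) (P : probability T R) (I : choiceType)
    (d' : measure_display) (T' : measurableType d')
    (X : I -> {RV P >-> T'}) (J : set I) :
  cylinders X J `<=` measurable.
Proof.
move=> _ [s [B [_ mB ->]]]; apply: fin_bigcap_measurable => // i _.
exact: measurable_funPTI.
Qed.

Lemma cylinders_setI_closed (d : measure_display) (T : measurableType d)
    (R : realType) (P : probability T R) (I : choiceType)
    (d' : measure_display) (T' : measurableType d')
    (X : I -> {RV P >-> T'}) (J : set I) :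
  setI_closed (cylinders X J).
Proof.
move=> _ _ [s [B [sJ mB ->]]] [t [C [tJ mC ->]]].
exists (s ++ t), (fun i => (if i \in s then B i else setT) `&`
                           (if i \in t then C i else setT)); split.
- by move=> i /=; rewrite mem_cat => /orP[/sJ|/tJ].
- by move=> i; apply: measurableI; case: ifP.
apply/seteqP; split=> w /=.
  by move=> [Bw Cw] i _; split; case: ifP => //; [exact: Bw|exact: Cw].
move=> BCw; split=> i /= si.
  by have := BCw i; rewrite /= mem_cat si => /(_ isT)[].
by have := BCw i; rewrite /= mem_cat si orbT => /(_ isT)[].
Qed.

Lemma cylinders_independent (d : measure_display) (T : measurableType d)
    (R : realType) (P : probability T R) (I : choiceType)
    (d' : measure_display) (T' : measurableType d')
    (X : I -> {RV P >-> T'}) (J K : set I) (A B : set T) :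
  mutually_independent P X -> J `&` K = set0 ->
  cylinders X J A -> cylinders X K B -> P (A `&` B) = (P A * P B)%E.
Proof.
move=> indX /seteqP[JK _] [s [C [sJ mC ->]]] [t [D [tK mD ->]]].
have disj i : i \in s -> i \notin t.
  by move=> si; apply/negP => /tK Ki; apply: (JK i); split=> //; exact: sJ.
(* Mutual independence takes a single family of sets and a repetition-free list: [E] glues [C] on
   [s] with [D] elsewhere, and [undup] removes repetitions. *)
pose E i := if i \in s then C i else D i.
have mE i : measurable (E i) by rewrite /E; case: ifP.
have -> : \bigcap_(i in [set` s]) X i @^-1` C i =
    \bigcap_(i in [set` undup s]) X i @^-1` E i.
  apply/seteqP; split=> w Xw i /= si; have := Xw i;
  by rewrite /E /= ?mem_undup in si *; rewrite si; apply.
have -> : \bigcap_(i in [set` t]) X i @^-1` D i =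
    \bigcap_(i in [set` undup t]) X i @^-1` E i.
  apply/seteqP; split=> w Xw i /= ti; have := Xw i;
  rewrite /E /= ?mem_undup in ti *; rewrite ti; case: ifP => [/disj|_]; 
  by rewrite ?ti//; apply.
rewrite -bigcap_setU.
have -> : [set` undup s] `|` [set` undup t] = [set` undup s ++ undup t].
  by apply/seteqP; split=> i /=; rewrite mem_cat => /orP.
rewrite !indX ?undup_uniq//; first by rewrite big_cat.
rewrite cat_uniq !undup_uniq/= andbT; apply/hasPn => i.
by rewrite !mem_undup; apply: contraL; exact: disj.
Qed.

Lemma sigma_of_measurable (d : measure_display) (T : measurableType d)
    (R : realType) (P : probability T R) (I : choiceType)
    (d' : measure_display) (T' : measurableType d')
    (X : I -> {RV P >-> T'}) (J : set I) :
  sigma_of X J `<=` measurable.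
Proof. exact/g_sigma_algebra_measurable/cylinders_measurable. Qed.

(** The Dynkin argument is applied twice, first reducing [A] to a cylinder with [B] fixed, then [B]
    to a cylinder. *)
Lemma sigma_of_independent (d : measure_display) (T : measurableType d)
    (R : realType) (P : probability T R) (I : choiceType)
    (d' : measure_display) (T' : measurableType d')
    (X : I -> {RV P >-> T'}) (J K : set I) (A B : set T) :
  mutually_independent P X -> J `&` K = set0 ->
  sigma_of X J A -> sigma_of X K B -> P (A `&` B) = (P A * P B)%E.
Proof.
move=> indX JK JA KB.
apply: g_sigma_algebra_independent JA;
  [exact: cylinders_measurable|exact: cylinders_setI_closed|
   exact: sigma_of_measurable KB|].
move=> C JC; rewrite setIC muleC.
apply: g_sigma_algebra_independent KB;
  [exact: cylinders_measurable|exact: cylinders_setI_closed|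
   exact: cylinders_measurable JC|].
by move=> D KD; rewrite setIC muleC; exact: cylinders_independent JC KD.
Qed.

Lemma sigma_of_sub (d : measure_display) (T : measurableType d)
    (R : realType) (P : probability T R) (I : choiceType)
    (d' : measure_display) (T' : measurableType d')
    (X : I -> {RV P >-> T'}) (J K : set I) :
  J `<=` K -> sigma_of X J `<=` sigma_of X K.
Proof.
move=> JK; apply: sub_sigma_algebra2 => _ [s [B [sJ mB ->]]].
by exists s, B; split=> //; exact: subset_trans JK.
Qed.

Lemma sigma_of_preimage (d : measure_display) (T : measurableType d)
    (R : realType) (P : probability T R) (I : choiceType)
    (d' : measure_display) (T' : measurableType d')
    (X : I -> {RV P >-> T'}) (J : set I) (i : I) (B : set T') :
  J i -> measurable B -> sigma_of X J (X i @^-1` B).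
Proof.
move=> Ji mB; apply: sub_sigma_algebra; exists [:: i], (fun=> B); split=> //.
  by move=> j /=; rewrite inE => /eqP ->.
apply/seteqP; split=> w /=.
  by move=> Bw j /=; rewrite inE => /eqP ->.
by move=> /(_ i); apply; rewrite /= inE.
Qed.

(** * Closure properties of generated sigma-algebras *)

Lemma g_sigma_algebra_setC (T : Type) (G : set (set T)) (A : set T) :
  <<s G >> A -> <<s G >> (~` A).
Proof. by rewrite -setTD; exact: sigma_algebraCD. Qed.

Lemma g_sigma_algebra_setI (T : Type) (G : set (set T)) (A B : set T) :
  <<s G >> A -> <<s G >> B -> <<s G >> (A `&` B).
Proof.
move=> GA GB; rewrite -(setCK (A `&` B)) setCI -bigcup2E.
apply: g_sigma_algebra_setC; apply: sigma_algebra_bigcup => -[|[|i]] /=.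
- exact: g_sigma_algebra_setC.
- exact: g_sigma_algebra_setC.
- exact: sigma_algebra0.
Qed.

Lemma g_sigma_algebra_setU (T : Type) (G : set (set T)) (A B : set T) :
  <<s G >> A -> <<s G >> B -> <<s G >> (A `|` B).
Proof.
move=> GA GB; rewrite -bigcup2E.
by apply: sigma_algebra_bigcup => -[|[|i]] //=; exact: sigma_algebra0.
Qed.

Lemma g_sigma_algebra_cst (T : Type) (G : set (set T)) (Q : Prop) :
  <<s G >> [set _ | Q].
Proof.
have [q|nq] := pselect Q.
  rewrite (_ : [set _ | Q] = setT); last by apply/seteqP; split.
  by have := g_sigma_algebra_setC (@sigma_algebra0 _ setT G); rewrite setC0.
rewrite (_ : [set _ | Q] = set0); first exact: sigma_algebra0.
by apply/seteqP; split.
Qed.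

Lemma g_sigma_algebra_bigcap (T : Type) (G : set (set T)) (A : (set T)^nat) :
  (forall n, <<s G >> (A n)) -> <<s G >> (\bigcap_n A n).
Proof.
move=> GA; rewrite -(setCK (\bigcap_n A n)) setC_bigcap.
apply: g_sigma_algebra_setC; apply: sigma_algebra_bigcup => n.
exact: g_sigma_algebra_setC.
Qed.

(** * Integer-valued variables: geometric tails, means and thinning *)

Lemma measurable_fun_nat (d : measure_display) (T : measurableType d)
    (X : T -> nat) :
  (forall k, measurable (X @^-1` [set k])) -> measurable_fun setT X.
Proof.
move=> mX _ Y _; rewrite setTI.
rewrite (_ : X @^-1` Y = \bigcup_(k in Y) X @^-1` [set k]).
  exact: bigcup_measurable.
by apply/seteqP; split=> [w Yw|w [k Yk /= ->]] //; exists (X w).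
Qed.

Lemma measurable_preimage_nat (d : measure_display) (T : measurableType d)
    (X : T -> nat) (Q : set nat) :
  measurable_fun setT X -> measurable [set w | Q (X w)].
Proof. by move=> mX; rewrite -[X in measurable X]setTI; exact: mX. Qed.

Lemma natr_eseries (R : realType) (n : nat) :
  (n%:R%:E = \sum_(0 <= k <oo) (((k < n)%N)%:R)%:E :> \bar R)%E.
Proof.
apply/esym/cvg_lim => //; apply: cvg_near_cst.
exists n => // l /= le_nl.
rewrite sumEFin; congr (_%:E).
rewrite (big_cat_nat _ le_nl)//= [X in _ + X]big1_seq ?addr0; last first.
  move=> i /andP[_]; rewrite mem_index_iota => /andP[ni _].
  by rewrite ltnNge ni.
rewrite (eq_big_nat _ _ (F2 := fun=> 1)); last by move=> i /andP[_ ->].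
by rewrite big_const_nat subn0 iter_addr_0.
Qed.

(** Tail-sum formula: the mean is the sum over [k] of [P(X > k) = q ^+ k.+1]. It serves for the
    offspring numbers and for V_N. *)
Lemma integral_geometric (d : measure_display) (T : measurableType d)
    (R : realType) (P : probability T R) (q : R) (X : T -> nat) :
  0 <= q -> q < 1 -> measurable_fun setT X ->
  (forall k, P [set w | (k <= X w)%N] = (q ^+ k)%:E) ->
  (\int[P]_w ((X w)%:R)%:E = (q / (1 - q))%:E)%E.
Proof.
move=> q0 q1 mX PX.
have mA k : measurable [set w | (k < X w)%N].
  exact: (measurable_preimage_nat [set n | (k < n)%N]).
under eq_integral => w _.
  rewrite natr_eseries.
  under eq_eseriesr => k _.
    rewrite (_ : ((k < X w)%N)%:R = \1_[set w | (k < X w)%N] w :> R); last first.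
      rewrite indicE; congr ((nat_of_bool _)%:R).
      by apply/esym; apply/idP/idP; rewrite inE.
    over.
  over.
rewrite integral_nneseries//; last first.
  by move=> k; apply/measurable_EFinP; exact: measurable_indic.
transitivity (\sum_(0 <= k <oo) (q ^+ k.+1)%:E)%E.
  by apply: eq_eseriesr => k _; rewrite integral_indic// setIT; exact: PX.
apply/cvg_lim => //.
rewrite (_ : (fun n => _) = EFin \o series (geometric q q)); last first.
  apply/funext => n /=; rewrite sumEFin; congr (_%:E).
  by apply: eq_bigr => k _; rewrite exprS.
apply: cvg_EFin; first exact: nearW.
by apply: cvg_geometric_series; rewrite ger0_norm.
Qed.

Lemma geometric_tail (d : measure_display) (T : measurableType d)
    (R : realType) (P : probability T R) (p : R) (x : {RV P >-> nat}) :
  (forall k, P (x @^-1` [set k]) = ((1 - p) * p ^+ k)%:E) ->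
  forall k, P [set w | (k <= x w)%N] = (p ^+ k)%:E.
Proof.
move=> Px; elim=> [|k IH].
  rewrite expr0 -(probability_setT P); congr (P _).
  by apply/seteqP; split.
have mk : measurable [set w | (k < x w)%N].
  exact: (measurable_funPTI x (Y := [set n | (k < n)%N])).
have mxk : measurable (x @^-1` [set k]) by exact: measurable_funPTI.
have : P [set w | (k <= x w)%N] =
    (P (x @^-1` [set k]) + P [set w | (k < x w)%N])%E.
  rewrite -measureU//; last first.
    by apply/seteqP; split=> w //= [->]; rewrite ltnn.
  congr (P _); apply/seteqP; split=> w /=.
    by rewrite leq_eqVlt => /predU1P[->|]; [left|right].
  by case=> [->//|/ltnW].
rewrite IH Px -(fineK (fin_num_measure P _ mk)) -EFinD => -[pk].
by congr (_%:E); rewrite exprS; lra.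
Qed.

(* With [T_j] the sum over [k] of [p ^ k * P (S k = j)], the total [S x] of the
   marks before a geometric time [x] satisfies [P (S x = j) = (1 - p) T_j] and,
   splitting at the [j.+1]-st mark, [P (j < S x) = p a T_j]; eliminating [T_j]
   gives a constant ratio of successive tails. *)
Lemma geometric_thinning (d : measure_display) (T : measurableType d)
    (R : realType) (P : probability T R) (p a : R) (x : {RV P >-> nat})
    (g : nat -> T -> bool) (S : nat -> T -> nat) :
  0 < p -> p < 1 -> 0 <= a ->
  (forall w, S 0%N w = 0%N) -> (forall k w, S k.+1 w = (S k w + g k w)%N) ->
  (forall k, measurable [set w | g k w]) ->
  (forall k j, measurable [set w | S k w = j]) ->
  (forall k, P (x @^-1` [set k]) = ((1 - p) * p ^+ k)%:E) ->
  (forall k j, P (x @^-1` [set k] `&` [set w | S k w = j]) =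
     (P (x @^-1` [set k]) * P [set w | S k w = j])%E) ->
  (forall k j, P ([set w | (k < x w)%N] `&`
                    ([set w | S k w = j] `&` [set w | g k w])) =
     (P [set w | (k < x w)%N] * (P [set w | S k w = j] * a%:E))%E) ->
  forall j, P [set w | (j <= S (x w) w)%N] =
    ((p * a / (1 - p + p * a)) ^+ j)%:E.
Proof.
move=> p0 p1 a0 S0 SS mg mS Px ind ind_g.
have Sle w : {homo S ^~ w : k l / (k <= l)%N}.
  apply: homo_leq => [//|k l n|k]; first exact: leq_trans.
  by rewrite SS leq_addr.
have mx (Y : set nat) : measurable (x @^-1` Y) by exact: measurable_funPTI.
have Ptail := geometric_tail Px.
pose Tj j := (\sum_(0 <= k <oo) (p ^+ k)%:E * P [set w | S k w = j])%E.
have eqE j : [set w | S (x w) w = j] =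
    \bigcup_k (x @^-1` [set k] `&` [set w | S k w = j]).
  by apply/seteqP; split=> [w Sj|w [k _ [/= ->]//]]; exists (x w).
(* The total exceeds [j] iff the [j.+1]-st mark falls on some trial [k] before time [x]: [j] marks
   before it and a mark at [k]. *)
have gtE j : [set w | (j < S (x w) w)%N] = \bigcup_k ([set w | (k < x w)%N] `&`
    ([set w | S k w = j] `&` [set w | g k w])).
  apply/seteqP; split=> [w|w [k _ [/= kx [Sk gk]]]]; last first.
    by apply: leq_trans (Sle w _ _ kx); rewrite SS Sk gk addn1.
  suff H n : (j < S n w)%N -> exists k, [/\ (k < n)%N, S k w = j & g k w].
    by case/H=> k [kx Sk gk]; exists k.
  elim: n => [|n IH]; first by rewrite S0.
  rewrite SS; have [/IH[k [kn Sk gk]] _|Snj] := ltnP j (S n w).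
    by exists k; split=> //; exact: ltnW.
  case gn : (g n w); last by rewrite addn0 ltnNge Snj.
  rewrite addn1 ltnS => jSn; exists n; split=> //.
  by apply/eqP; rewrite eqn_leq Snj.
have m1 j k : measurable (x @^-1` [set k] `&` [set w | S k w = j]).
  exact: measurableI.
have m2 j k : measurable ([set w | (k < x w)%N] `&`
    ([set w | S k w = j] `&` [set w | g k w])).
  by apply: measurableI; [exact: (mx [set n | (k < n)%N])|exact: measurableI].
have Peq j : P [set w | S (x w) w = j] = ((1 - p)%:E * Tj j)%E.
  rewrite eqE measure_semi_bigcup//; last 2 first.
  - by move=> k l _ _ [w [[/= <- _] [/= <- _]]].
  - exact: bigcup_measurable.
  rewrite -nneseriesZl//; last first.
    by move=> k _; rewrite mule_ge0// lee_fin exprn_ge0// ltW.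
  apply: eq_eseriesr => k _; apply: etrans (ind k j) _.
  by rewrite Px muleA EFinM.
have Pgt j : P [set w | (j < S (x w) w)%N] = ((p * a)%:E * Tj j)%E.
  rewrite gtE measure_semi_bigcup//; last 2 first.
  (* Disjointness: [j] marks before [k] and a mark at [k] leave at least [j.+1] marks before any
     later trial. *)
  - move=> k l _ _ [w [[/= _ [Sk gk]] [/= _ [Sl gl]]]].
    have [lt|lt|//] := ltngtP k l.
      by have := Sle w _ _ lt; rewrite SS gk Sk Sl addn1 ltnn.
    by have := Sle w _ _ lt; rewrite SS gl Sk Sl addn1 ltnn.
  - exact: bigcup_measurable.
  rewrite -nneseriesZl//; last first.
    by move=> k _; rewrite mule_ge0// lee_fin exprn_ge0// ltW.
  apply: eq_eseriesr => k _; apply: etrans (ind_g k j) _.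
  rewrite Ptail exprS !EFinM -!muleA [in RHS](muleCA a%:E).
  by congr (_ * (_ * _))%E; rewrite muleC.
have meq j : measurable [set w | S (x w) w = j].
  by rewrite eqE; exact: bigcup_measurable.
have mgt j : measurable [set w | (j < S (x w) w)%N].
  by rewrite gtE; exact: bigcup_measurable.
have c0 : 0 < 1 - p + p * a by rewrite ltr_wpDr ?subr_gt0// mulr_ge0// ltW.
elim=> [|j IH].
  rewrite expr0 -(probability_setT P); congr (P _).
  by apply/seteqP; split.
have : P [set w | (j <= S (x w) w)%N] =
    (P [set w | S (x w) w = j] + P [set w | (j < S (x w) w)%N])%E.
  rewrite -measureU//; last first.
    by apply/seteqP; split=> w //= [->]; rewrite ltnn.
  congr (P _); apply/seteqP; split=> w /=.
    by rewrite leq_eqVlt => /predU1P[->|]; [left|right].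
  by case=> [->//|/ltnW].
(* Both probabilities are multiples of [Tj j], which drops out; as the induction hypothesis gives
   their sum, this linear relation determines the next tail. *)
have : ((1 - p)%:E * P [set w | (j < S (x w) w)%N] =
    (p * a)%:E * P [set w | S (x w) w = j])%E.
  by rewrite Peq Pgt muleCA.
rewrite IH -(fineK (fin_num_measure P _ (meq j))).
rewrite -(fineK (fin_num_measure P _ (mgt j))) -!EFinM -EFinD.
set e := fine _; set h := fine _ => -[he] -[rj].
congr (_%:E); rewrite exprS rj.
by apply: (mulIf (lt0r_neq0 c0)); rewrite [RHS]mulrAC divfK ?lt0r_neq0//; lra.
Qed.

(** * The fixed-point map and its link to the equation for tau *)

(** The probability that at least [N] children are marked when each is so with probability [a]; the
    base is the ratio of the thinned geometric law. *)
Definition nary_map (R : realType) (p : R) (N : nat) (a : R) : R :=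
  (p * a / (1 - p + p * a)) ^+ N.

Lemma nary_map_den_gt0 (R : realType) (p a : R) :
  0 < p -> p < 1 -> 0 <= a -> 0 < 1 - p + p * a.
Proof. by move=> p0 p1 a0; rewrite ltr_wpDr ?subr_gt0// mulr_ge0// ltW. Qed.

Lemma nary_map_ge0 (R : realType) (p : R) (N : nat) (a : R) :
  0 < p -> p < 1 -> 0 <= a -> 0 <= nary_map p N a.
Proof.
move=> p0 p1 a0; rewrite exprn_ge0// divr_ge0 ?mulr_ge0 ?(ltW p0)//.
exact/ltW/nary_map_den_gt0.
Qed.

Lemma nary_map_lt1 (R : realType) (p : R) (N : nat) (a : R) :
  (1 <= N)%N -> 0 < p -> p < 1 -> 0 <= a -> nary_map p N a < 1.
Proof.
move=> N1 p0 p1 a0; have c0 := nary_map_den_gt0 p0 p1 a0.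
rewrite exprn_ilt1 ?lt0n_neq0// ?divr_ge0 ?mulr_ge0 ?(ltW p0) ?(ltW c0)//.
by rewrite ltr_pdivrMr// mul1r ltrDr subr_gt0.
Qed.

Lemma nary_map_le (R : realType) (p : R) (N : nat) (a b : R) :
  0 < p -> p < 1 -> 0 <= a -> a <= b -> nary_map p N a <= nary_map p N b.
Proof.
move=> p0 p1 a0 ab; have b0 := le_trans a0 ab.
have ca := nary_map_den_gt0 p0 p1 a0; have cb := nary_map_den_gt0 p0 p1 b0.
have ge0 c : 0 <= c -> 0 <= p * c / (1 - p + p * c).
  by move=> c0; rewrite divr_ge0 ?mulr_ge0 ?(ltW p0)// ltW// nary_map_den_gt0.
rewrite lerXn2r ?nnegrE ?ge0// ler_pdivrMr// mulrAC ler_pdivlMr//.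
have : 0 <= p * (1 - p) * (b - a) by rewrite !mulr_ge0 ?subr_ge0// ltW.
by lra.
Qed.

(** The base of [nary_map] equals [t / (t + 1/m)] with [m = p / (1 - p)]. Both sides carry one
    factor [t] more than the equation for tau, so that [t = 0] is covered. *)
Lemma nary_map_fixE (R : realType) (p : R) (N : nat) (t : R) :
  0 < p -> p < 1 -> 0 <= t ->
  t = nary_map p N t <-> t * (t + 1 / (p / (1 - p))) ^+ N = t ^+ N.
Proof.
move=> p0 p1 t0; have q0 : 0 < 1 - p by rewrite subr_gt0.
have c0 : 0 < t + 1 / (p / (1 - p)) by rewrite ltr_wpDl// !divr_gt0.
rewrite /nary_map (_ : p * t / _ = t / (t + 1 / (p / (1 - p)))); last first.
  by field; rewrite !lt0r_neq0//= mulrC addrC nary_map_den_gt0.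
rewrite expr_div_n; have /lt0r_neq0 cN := exprn_gt0 N c0.
by split=> [tE|<-]; [rewrite {1}tE divfK|rewrite mulfK].
Qed.

(** Solutions of the tau equation are fixed points, hence at most [t]; a positive fixed point solves
    it after cancelling one factor [t]. *)
Lemma nary_map_is_tau (R : realType) (p : R) (N : nat) (t : R) :
  (1 <= N)%N -> 0 < p -> p < 1 -> 0 <= t -> t <= 1 -> t = nary_map p N t ->
  (forall s, 0 <= s -> s <= 1 -> s = nary_map p N s -> s <= t) ->
  is_tau N (p / (1 - p)) t.
Proof.
case: N => // N _ p0 p1 t0 t1 tfix tmax.
have sol s : tau_solutions N.+1 (p / (1 - p)) s -> s <= t.
  move=> [/andP[s0 s1] /= sE]; apply: tmax => //.
  by apply/(nary_map_fixE N.+1 p0 p1 s0); rewrite sE exprS.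
have [t_gt0|] := boolP (0 < t).
  left; split=> //; split; first by rewrite t0.
  move/(nary_map_fixE N.+1 p0 p1 t0): tfix; rewrite [in RHS]exprS.
  by move/(mulfI (lt0r_neq0 t_gt0)).
rewrite -leNgt => t_le0; have tE : t = 0.
  by apply/eqP; rewrite eq_le t_le0.
(* At [t = 0] nothing can be cancelled. A solution, if any, is squeezed to 0, as for [N = 1] and
   [m = 1] where [0 ^+ 0 = 1]; otherwise the default value 0 applies. *)
have [[s ss]|none] := pselect (exists s, tau_solutions N.+1 (p / (1 - p)) s).
  left; split=> //; suff <- : s = t by [].
  by apply/eqP; rewrite eq_le sol//= tE; case: ss => /andP[].
by right; split=> //; apply/seteqP; split=> // s ss; apply: none; exists s.
Qed.

(** * Events determined by the offspring numbers below a node *)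

Definition descendants (u : seq nat) : set (seq nat) := [set v | prefix u v].

Lemma descendants_rconsS (u : seq nat) (i : nat) :
  descendants (rcons u i) `<=` descendants u.
Proof. by move=> v; rewrite /descendants /= -cats1; exact: catl_prefix. Qed.

Lemma descendants_rcons_neq (u : seq nat) (i : nat) :
  ~ descendants (rcons u i) u.
Proof. by move=> /size_prefix; rewrite size_rcons ltnn. Qed.

Lemma descendants_rcons_inj (u v : seq nat) (i j : nat) :
  descendants (rcons u i) v -> descendants (rcons u j) v -> i = j.
Proof.
move=> /prefixP[s ->] /prefixP[t]; rewrite !cat_rcons => /eqP.
by rewrite eqseq_cat// eqxx/= eqseq_cons => /andP[/eqP].
Qed.

(** Induction on [k], splitting on the mark of the last child; [Q] is general because a mark there
    shifts it by one. *)
Lemma g_sigma_algebra_marked (T : Type) (F : set (set T))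
    (M : T -> pred (seq nat)) (u : seq nat) (k : nat) (Q : set nat) :
  (forall i, (i < k)%N -> <<s F >> [set w | M w (rcons u i)]) ->
  <<s F >> [set w | Q (size (marked_children (M w) k u))].
Proof.
elim: k Q => [|k IH] Q FM; first exact: (@g_sigma_algebra_cst _ F (Q 0%N)).
have FMk := FM k (ltnSn k).
have {}IH Y : <<s F >> [set w | Y (size (marked_children (M w) k u))].
  by apply: IH => i ik; apply: FM; exact: ltnW.
rewrite (_ : [set w | _] =
    [set w | Q (size (marked_children (M w) k u)).+1] `&`
      [set w | M w (rcons u k)] `|`
    [set w | Q (size (marked_children (M w) k u))] `&`
      ~` [set w | M w (rcons u k)]).
  apply: g_sigma_algebra_setU; apply: g_sigma_algebra_setI => //.
  - exact: (IH [set n | Q n.+1]).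
  - exact: g_sigma_algebra_setC.
apply/seteqP; split=> w /=; rewrite size_marked_childrenS.
  by case: (M w (rcons u k)); rewrite ?addn1 ?addn0; [left|right; split].
by case=> [[Qw ->]|[Qw /negP/negbTE ->]]; rewrite ?addn1 ?addn0.
Qed.

Lemma sigma_of_marked (d : measure_display) (T : measurableType d)
    (R : realType) (P : probability T R) (xi : seq nat -> {RV P >-> nat})
    (M : T -> pred (seq nat)) (u : seq nat) (Q : set nat) :
  (forall i, sigma_of xi (descendants (rcons u i)) [set w | M w (rcons u i)]) ->
  sigma_of xi (descendants u)
    [set w | Q (size (marked_children (M w) (xi u w) u))].
Proof.
(* The number of children is random; on each event [xi u = k] it is replaced by the constant [k]. *)
move=> xiM; rewrite (_ : [set w | _] = \bigcup_k (xi u @^-1` [set k] `&`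
    [set w | Q (size (marked_children (M w) k u))])); last first.
  by apply/seteqP; split=> [w Qw|w [k _ [/= ->]//]]; exists (xi u w).
apply: sigma_algebra_bigcup => k; apply: g_sigma_algebra_setI.
  by apply: sigma_of_preimage => //; exact: prefix_refl.
apply: g_sigma_algebra_marked => i _.
exact: (sigma_of_sub (@descendants_rconsS u i)) (xiM i).
Qed.

(** Thinning applies because [xi u], the marks of the first [k] children and the mark of child [k]
    depend on the pairwise disjoint label sets [[set u]], [J k] and [descendants (rcons u k)]. *)
Lemma marked_children_law (d : measure_display) (T : measurableType d)
    (R : realType) (P : probability T R) (p a : R)
    (xi : seq nat -> {RV P >-> nat}) (M : T -> pred (seq nat)) (u : seq nat) :
  0 < p -> p < 1 -> 0 <= a -> mutually_independent P xi ->
  (forall k, P (xi u @^-1` [set k]) = ((1 - p) * p ^+ k)%:E) ->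
  (forall i, sigma_of xi (descendants (rcons u i)) [set w | M w (rcons u i)]) ->
  (forall i, P [set w | M w (rcons u i)] = a%:E) ->
  forall j, P [set w | (j <= size (marked_children (M w) (xi u w) u))%N] =
    ((p * a / (1 - p + p * a)) ^+ j)%:E.
Proof.
move=> p0 p1 a0 indxi xiu xiM PM.
pose J k := [set v | exists2 i, (i < k)%N & descendants (rcons u i) v].
pose K := [set v | exists i, descendants (rcons u i) v].
have sigmaS k j : sigma_of xi (J k)
    [set w | size (marked_children (M w) k u) = j].
  apply: (g_sigma_algebra_marked [set j]) => i ik.
  by apply: (sigma_of_sub _ (xiM i)) => v; exists i.
have sigmaSK k j : sigma_of xi K
    [set w | size (marked_children (M w) k u) = j].
  by apply: (sigma_of_sub _ (sigmaS k j)) => v [i _ iv]; exists i.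
have sigmaM k : sigma_of xi K [set w | M w (rcons u k)].
  by apply: (sigma_of_sub _ (xiM k)) => v; exists k.
have sigmax (Y : set nat) : sigma_of xi [set u] (xi u @^-1` Y).
  exact: sigma_of_preimage.
have uK : [set u] `&` K = set0.
  by apply/seteqP; split=> // v [/= ->] [i /descendants_rcons_neq].
apply: (geometric_thinning (g := fun k w => M w (rcons u k))
  (S := fun k w => size (marked_children (M w) k u))) => //.
- by move=> k w; exact: size_marked_childrenS.
- by move=> k; exact: sigma_of_measurable (sigmaM k).
- by move=> k j; exact: sigma_of_measurable (sigmaS k j).
- by move=> k j; exact: (sigma_of_independent indxi uK).
- move=> k j; rewrite -(PM k).
  rewrite -(sigma_of_independent indxi _ (sigmaS k j) (xiM k)); last first.
    apply/seteqP; split=> // v [[i ik iv] kv].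
    by move: ik; rewrite (descendants_rcons_inj iv kv) ltnn.
  apply: (sigma_of_independent indxi uK).
    exact: (sigmax [set n | (k < n)%N]).
  exact: g_sigma_algebra_setI (sigmaSK k j) (sigmaM k).
Qed.

Lemma sigma_of_nary_upto (d : measure_display) (T : measurableType d)
    (R : realType) (P : probability T R) (xi : seq nat -> {RV P >-> nat})
    (N n : nat) (u : seq nat) :
  sigma_of xi (descendants u) [set w | nary_upto (xi ^~ w) N n u].
Proof.
elim: n u => [|n IH] u; first exact: (@g_sigma_algebra_cst _ _ true).
exact: (sigma_of_marked (M := fun w => nary_upto (xi ^~ w) N n)
  [set l | (N <= l)%N]).
Qed.

Lemma nary_rootE_bigcap (T : Type) (x : T -> seq nat -> nat) (N : nat)
    (u : seq nat) :
  [set w | nary_root (x w) N u] = \bigcap_n [set w | nary_upto (x w) N n u].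
Proof.
apply/seteqP; split=> w /=; first by move=> /asboolP uroot n _; exact: uroot.
by move=> uroot; apply/asboolP => n; exact: uroot.
Qed.

Lemma sigma_of_nary_root (d : measure_display) (T : measurableType d)
    (R : realType) (P : probability T R) (xi : seq nat -> {RV P >-> nat})
    (N : nat) (u : seq nat) :
  sigma_of xi (descendants u) [set w | nary_root (xi ^~ w) N u].
Proof.
rewrite nary_rootE_bigcap; apply: g_sigma_algebra_bigcap => n.
exact: sigma_of_nary_upto.
Qed.

(** * The probability of being N-ary as a limit of iterates *)

Lemma prob_nary_upto (d : measure_display) (T : measurableType d)
    (R : realType) (P : probability T R) (p : R)
    (xi : seq nat -> {RV P >-> nat}) (N n : nat) (u : seq nat) :
  0 < p -> p < 1 -> mutually_independent P xi ->
  (forall u k, P (xi u @^-1` [set k]) = ((1 - p) * p ^+ k)%:E) ->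
  P [set w | nary_upto (xi ^~ w) N n u] = (iter n (nary_map p N) 1)%:E.
Proof.
move=> p0 p1 indxi xiE; elim: n u => [|n IH] u.
  by rewrite -(probability_setT P); congr (P _); apply/seteqP; split.
apply: (marked_children_law (M := fun w => nary_upto (xi ^~ w) N n)) => //.
  by elim: n {IH} => //= n IH; exact: nary_map_ge0.
by move=> i; exact: sigma_of_nary_upto.
Qed.

(** Continuity from above along the decreasing finite-depth events. *)
Lemma cvg_prob_nary_root (d : measure_display) (T : measurableType d)
    (R : realType) (P : probability T R) (p : R)
    (xi : seq nat -> {RV P >-> nat}) (N : nat) (u : seq nat) :
  0 < p -> p < 1 -> mutually_independent P xi ->
  (forall u k, P (xi u @^-1` [set k]) = ((1 - p) * p ^+ k)%:E) ->
  ((iter n (nary_map p N) 1)%:E @[n --> \oo] -->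
    P [set w | nary_root (xi ^~ w) N u])%E.
Proof.
move=> p0 p1 indxi xiE.
have mupto n := sigma_of_measurable (@sigma_of_nary_upto _ _ _ _ xi N n u).
rewrite nary_rootE_bigcap.
under eq_fun => n do
  rewrite -(@prob_nary_upto _ _ _ _ _ _ N n u p0 p1 indxi xiE).
apply: nonincreasing_cvg_mu => //.
- by rewrite (le_lt_trans (probability_le1 _ _)) ?ltry.
- exact: bigcapT_measurable.
- by move=> m n mn; apply/subsetPset => w; exact: nary_upto_leq.
Qed.

(** * Law and mean of V_N *)

Theorem mainTheorem4 (R : realType) (d : measure_display)
    (T : measurableType d) (P : probability T R)
    (N : nat) (p : R) (xi : seq nat -> {RV P >-> nat}) :
  (1 <= N)%N -> 0 < p -> p < 1 ->
  mutually_independent P xi ->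
  (forall (u : seq nat) (k : nat),
     P (xi u @^-1` [set k]) = ((1 - p) * p ^+ k)%:E) ->
  let m := p / (1 - p) in
  let V (w : T) : \bar R :=
    num_disjoint_nary_subtrees R N (family_tree (fun u => xi u w)) in
  (forall u : seq nat, ('E_P[fun w : T => (xi u w)%:R] = m%:E)%E) /\
  exists tau : R,
    [/\ is_tau N m tau,
        measurable_fun setT V,
        forall j : nat,
          P (V @^-1` [set (j%:R)%:E]) = ((1 - tau) * tau ^+ j)%:E &
        (\int[P]_w V w = (tau * (1 - tau)^-1)%:E)%E].
Proof.
move=> N1 p0 p1 indxi xiE m V; split=> [u|].
  rewrite unlock; apply: integral_geometric => //; first exact: ltW.
  exact: geometric_tail.
have mroot := sigma_of_measurable (@sigma_of_nary_root _ _ _ _ xi N [::]).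
have cvg_root v : ((iter n (nary_map p N) 1)%:E @[n --> \oo] -->
    P [set w | nary_root (xi ^~ w) N v])%E by exact: cvg_prob_nary_root.
pose t := fine (P [set w | nary_root (xi ^~ w) N [::]]).
(* The iterates do not depend on the node, so every node is N-ary with the ancestor's probability
   [t]. *)
have Proot u : P [set w | nary_root (xi ^~ w) N u] = t%:E.
  rewrite fineK ?fin_num_measure//.
  by rewrite -(cvg_lim _ (cvg_root u))// -(cvg_lim _ (cvg_root [::])).
have t0 : 0 <= t by rewrite fine_ge0.
have t1 : t <= 1 by rewrite -lee_fin -(Proot [::]) probability_le1.
pose Z w := size (marked_children (nary_root (xi ^~ w) N) (xi [::] w) [::]).
have Zlaw := marked_children_law (M := fun w => nary_root (xi ^~ w) N)
  p0 p1 t0 indxi (xiE [::])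
  (fun i => @sigma_of_nary_root _ _ _ _ xi N (rcons [::] i))
  (fun i => Proot (rcons [::] i)).
set r := p * t / (1 - p + p * t) in Zlaw.
have tfix : t = nary_map p N t.
  apply: EFin_inj; rewrite -(Proot [::]) -/r -Zlaw; congr (P _).
  by apply/seteqP; split=> w /=; rewrite nary_rootE.
have t_lt1 : t < 1 by rewrite tfix nary_map_lt1.
have VE w : V w = ((Z w %/ N)%:R)%:E by exact: num_disjoint_nary_subtreesE.
(* As [t = r ^+ N], the event [N * j <= Z] has probability [r ^+ (N * j) = t ^+ j]. *)
have Vlaw j : P [set w | (j <= Z w %/ N)%N] = (t ^+ j)%:E.
  rewrite [in RHS]tfix -exprM mulnC -Zlaw; congr (P _).
  by apply/seteqP; split=> w /=; rewrite leq_divRL.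
have mZ : measurable_fun setT (fun w => Z w %/ N)%N.
  apply: measurable_fun_nat => k.
  apply: (sigma_of_measurable (sigma_of_marked
    (M := fun w => nary_root (xi ^~ w) N) (u := [::]) [set l | (l %/ N)%N = k]
    (fun i => @sigma_of_nary_root _ _ _ _ xi N (rcons [::] i)))).
exists t; split.
(* Maximality: a fixed point [s <= 1] stays below every iterate started at 1 by monotonicity, hence
   below their limit [t]. *)
- apply: nary_map_is_tau => // s s0 s1 sfix; rewrite -lee_fin -(Proot [::]).
  rewrite -(cvg_lim _ (cvg_root [::]))//; apply: lime_ge.
    exact: cvgP (cvg_root [::]).
  apply: nearW => n; rewrite lee_fin; elim: n => //= n IH.
  by rewrite [leLHS]sfix nary_map_le.
- rewrite (_ : V = (fun n => (n%:R)%:E) \o (fun w => Z w %/ N)%N); last exact/funext.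
  exact: measurableT_comp.
- move=> j; rewrite (_ : V @^-1` _ =
    [set w | (j <= Z w %/ N)%N] `\` [set w | (j < Z w %/ N)%N]); last first.
    apply/seteqP; split=> w /=; rewrite VE.
      by move=> [/eqP]; rewrite eqr_nat => /eqP ->; rewrite leqnn ltnn.
    move=> [jZ /negP]; rewrite -leqNgt => Zj; congr ((_%:R)%:E).
    by apply/eqP; rewrite eqn_leq Zj.
  have mj k : measurable [set w | (k <= Z w %/ N)%N].
    exact: (measurable_preimage_nat [set n | (k <= n)%N] mZ).
  rewrite measureD//; last first.
    by rewrite (le_lt_trans (probability_le1 _ _)) ?ltry.
  rewrite setIidr; last by move=> w /= /ltnW.
  apply: etrans (congr2 (fun x y => x - y)%E (Vlaw j) (Vlaw j.+1)) _.
  by rewrite -EFinB exprS mulrBl mul1r.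
- under eq_integral do rewrite VE.
  exact: integral_geometric.
Qed.
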